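(* Let $q:\mathcal U\to\mathbb R^p$ be continuous, differentiable on $\mathrm{Int}(\mathcal U)$, with derivative $Dq$ symmetric and positive definite on $\mathrm{Int}(\mathcal U)$, and suppose the image $\mathcal Y:=q(\mathcal U)$ is convex. Then the restriction $q|_{\mathrm{Int}(\mathcal U)}$ is a continuous bijection from $\mathrm{Int}(\mathcal U)$ onto $\mathrm{Int}(\mathcal Y)$.
   Context: $\mathcal U\subset\mathbb R^p$ is a compact convex set (with piecewise $C^1$ boundary and nonempty interior). $Dq$ denotes the Jacobian matrix of $q$. *)

(* Defs.v *)
From HB Require Import structures.
From mathcomp Require Import all_boot all_order all_algebra.
From mathcomp Require Import all_classical all_reals all_analysis.
Set Implicit Arguments. Unset Strict Implicit. Unset Printing Implicit Defensive.
Import Order.TTheory GRing.Theory Num.Theory.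
Import numFieldNormedType.Exports.
Local Open Scope ring_scope.

Definition sym_posdef (R : realType) (p : nat) (M : 'M[R]_p) : Prop :=
  M^T = M /\ forall v : 'rV[R]_p, v != 0 -> 0 < (v *m M *m v^T) 0 0.

(* Main.v *)
Require Import Defs.
From HB Require Import structures.
From mathcomp Require Import all_boot all_order all_algebra.
From mathcomp Require Import all_classical all_reals all_analysis.
From mathcomp Require Import ring lra.
Import Order.TTheory GRing.Theory Num.Theory.
Import numFieldNormedType.Exports.
Local Open Scope classical_set_scope.
Local Open Scope ring_scope.

(** Injectivity is strict monotonicity of [q] along segments that start in the
    interior.  For [y] close to [q x], [x] interior, a minimiser of [|q - y|^2]
    over [U] stays away from the boundary, and positive definiteness at the
    minimiser forces [q = y] there; hence interior points go to interior points.

    For the converse, the symmetry of the Jacobian makes the line integral of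
    [q] vanish around triangles.  As [q] is only differentiable, this is proved
    by Goursat's subdivision argument.  Together with monotonicity it makes [q]
    cyclically monotone on triples of points of [U].
    Suppose that a boundary point has its image in the interior of [q @` U].
    Projecting a nearby outside point onto [U] gives a boundary point [u] with
    an outward normal [n] and [q u] still interior, so that [q u + t n = q a]
    for some [a] in [U] and some [t > 0].  Monotonicity gives [<n, a - u> = 0],
    and cyclic monotonicity of [a], [u] and a point of the segment from an
    interior point [z] to [a], which is then moved to [a], gives
    [<n, z - a> >= 0], whereas [<n, z - u> < 0]. *)

(** * Dot product of row vectors and its comparison with the sup norm *)

Section Dot.
Context {R : realType} {p : nat}.
Implicit Types (u v w : 'rV[R]_p) (M : 'M[R]_p).

Definition dot u v : R := (u *m v^T) 0 0.

Lemma dotE u v : dot u v = \sum_i u 0 i * v 0 i.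
Proof. by rewrite /dot mxE; apply: eq_bigr => i _; rewrite mxE. Qed.

Lemma dotC u v : dot u v = dot v u.
Proof. by rewrite !dotE; apply: eq_bigr => i _; rewrite mulrC. Qed.

Lemma dotDl u v w : dot (u + v) w = dot u w + dot v w.
Proof. by rewrite /dot mulmxDl mxE. Qed.

Lemma dotZl (k : R) u v : dot (k *: u) v = k * dot u v.
Proof. by rewrite /dot -scalemxAl mxE. Qed.

Lemma dotNl u v : dot (- u) v = - dot u v.
Proof. by rewrite -scaleN1r dotZl mulN1r. Qed.

Lemma dotDr u v w : dot w (u + v) = dot w u + dot w v.
Proof. by rewrite dotC dotDl !(dotC w). Qed.

Lemma dotZr (k : R) u v : dot v (k *: u) = k * dot v u.
Proof. by rewrite dotC dotZl dotC. Qed.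

Lemma dotNr u v : dot v (- u) = - dot v u.
Proof. by rewrite dotC dotNl dotC. Qed.

Definition dot_lin := (dotDl, dotDr, dotNl, dotNr, dotZl, dotZr).

Lemma dot0l v : dot 0 v = 0.
Proof. by rewrite -(scale0r 0) dotZl mul0r. Qed.

Lemma norm_coord_le u i : `|u 0 i| <= `|u|.
Proof.
rewrite [leRHS]mx_normrE.
by have /= := le_bigmax (0:R) (fun k : 'I_1 * 'I_p => `|u k.1 k.2|) (0, i).
Qed.

(** The norm is the sup norm, so each of the [p] products of coordinates is at most [|u| * |v|];
    hence the factor [p%:R]. *)
Lemma dot_norm_le u v : `|dot u v| <= p%:R * (`|u| * `|v|).
Proof.
rewrite dotE (le_trans (ler_norm_sum _ _ _))//.
have -> : p%:R * (`|u| * `|v|) = \sum_(i < p) (`|u| * `|v|).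
  by rewrite sumr_const card_ord mulr_natl.
by apply: ler_sum => i _; rewrite normrM ler_pM// norm_coord_le.
Qed.

Lemma norm_sqr_le_dot u : `|u| ^+ 2 <= dot u u.
Proof.
have [->|u0] := eqVneq u 0; first by rewrite normr0 expr0n/= dot0l.
have /mx_norm_neq0[[i j] uE] : mx_norm u != 0 by rewrite -normr_eq0 in u0.
rewrite -[`|u|]/(mx_norm u) uE /= ord1 dotE (bigD1 j)//= real_normK ?num_real//.
rewrite expr2 lerDl; apply: sumr_ge0 => k _.
by rewrite -expr2 sqr_ge0.
Qed.

Lemma dot_ge0 u : 0 <= dot u u.
Proof. by apply: le_trans (norm_sqr_le_dot u); rewrite sqr_ge0. Qed.

Lemma dot_gt0 u : u != 0 -> 0 < dot u u.
Proof.
by move=> u0; apply: lt_le_trans (norm_sqr_le_dot u); rewrite exprn_gt0 ?normr_gt0.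
Qed.

Lemma dot_sym M u v : M^T = M -> dot (u *m M) v = dot (v *m M) u.
Proof.
by move=> MT; rewrite dotC /dot trmx_mul MT mulmxA.
Qed.

End Dot.

(** * Epsilon-delta forms of continuity, interior and differentiability *)

Section EpsilonDelta.
Context {R : realType} {V W : normedModType R}.

Lemma within_continuousP (A : set V) (f : V -> W) :
  {within A, continuous f} <->
  (forall x, A x -> forall e : R, 0 < e -> exists2 d : R, 0 < d &
     forall y, A y -> `|y - x| < d -> `|f y - f x| < e).
Proof.
rewrite subspace_continuousP; split=> [cf x Ax e e0|cf x Ax].
  have /cvgrPdist_lt/(_ e e0) := cf x Ax.
  rewrite /within /= -nbhs_nearE => /nbhs_normP[d /= d0 fd]; exists d => // y Ay yx.
  by rewrite distrC; apply: fd => //=; rewrite distrC.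
apply/cvgrPdist_lt => e e0; have [d d0 fd] := cf x Ax e e0.
rewrite /within /= -nbhs_nearE; apply/nbhs_normP; exists d => //= y xy Ay.
by rewrite distrC; apply: fd => //; rewrite distrC.
Qed.

Lemma continuous_atP (f : V -> W) x : {for x, continuous f} <->
  (forall e : R, 0 < e -> exists2 d : R, 0 < d &
     forall y, `|y - x| < d -> `|f y - f x| < e).
Proof.
split=> [/cvgrPdist_lt cf e e0|cf].
  have /nbhs_normP[d /= d0 fd] := cf e e0; exists d => // y yx.
  by rewrite distrC; apply: fd => //=; rewrite distrC.
apply/cvgrPdist_lt => e e0; have [d d0 fd] := cf e e0.
apply/nbhs_normP; exists d => //= y xy.
by rewrite distrC; apply: fd => //; rewrite distrC.
Qed.

Lemma interiorP (A : set V) x : interior A x <->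
  exists2 d : R, 0 < d & forall y, `|y - x| < d -> A y.
Proof.
split=> [/nbhs_normP[d /= d0 Ad]|[d d0 Ad]].
  by exists d => // y yx; apply: Ad => /=; rewrite distrC.
by apply/nbhs_normP; exists d => //= y yx; apply: Ad; rewrite distrC.
Qed.

End EpsilonDelta.

Lemma jacobian_approx {R : realType} {p : nat} {q : 'rV[R]_p -> 'rV[R]_p} {x} :
  differentiable q x -> forall e : R, 0 < e -> exists2 d : R, 0 < d &
    forall y, `|y - x| < d ->
      `|q y - q x - (y - x) *m 'J q x| <= e * `|y - x|.
Proof.
move=> dq e e0.
have := diff_locally dq => /eqaddoP/(_ e e0)/nbhs_normP[d /= d0 qd].
exists d => // y yx.
have := qd (y - x); rewrite /= sub0r normrN => /(_ yx).
rewrite !fctE /= subrK mul_rV_lin1 /=.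
by rewrite opprD addrA.
Qed.

Lemma is_derive1_approx (R : realType) (f : R -> R) (x df : R) :
  (forall e : R, 0 < e -> exists2 d : R, 0 < d &
     forall h, `|h| < d -> `|f (x + h) - f x - h * df| <= e * `|h|) ->
  is_derive x 1 f df.
Proof.
move=> fx.
have cf : h^-1 *: (f (h *: (1 : R) + x) - f x) @[h --> 0^'] --> df.
  apply/cvgrPdist_le => e e0; have [d d0 fd] := fx e e0.
  apply/nbhs_normP; exists d => //= h.
  rewrite /ball_/= sub0r normrN => hd h0.
  have hn0 : 0 < `|h| by rewrite normr_gt0.
  have hh : h^-1 * h = 1 by rewrite mulVf.
  rewrite distrC [h *: 1]mulr1 -(ler_pM2r hn0) -normrM.
  have -> : (h^-1 *: (f (h + x) - f x) - df) * h =
            (h^-1 * h) * (f (x + h) - f x) - h * df.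
    by rewrite /GRing.scale/= (addrC x); ring.
  by rewrite hh mul1r; exact: fd.
have dfx : derivable f x 1 by apply/cvg_ex; exists df.
by apply: DeriveDef => //; exact/cvg_lim.
Qed.

(** * Segments and derivatives along them *)

Section Segment.
Context {R : realType} {p : nat}.
Implicit Types (a b c w x y : 'rV[R]_p) (t : R) (q : 'rV[R]_p -> 'rV[R]_p).

Definition seg a b t := a + t *: (b - a).

Lemma seg0 a b : seg a b 0 = a.
Proof. by rewrite /seg scale0r addr0. Qed.

Lemma seg1 a b : seg a b 1 = b.
Proof. by rewrite /seg scale1r addrC subrK. Qed.

Lemma segE a b t : seg a b t = (1 - t) *: a + t *: b.
Proof. by apply/rowP => i; rewrite !mxE; ring. Qed.

Lemma seg_seg a b u v t :
  seg (seg a b u) (seg a b v) t = seg a b (u + t * (v - u)).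
Proof. by apply/rowP => i; rewrite !mxE; ring. Qed.

Lemma segB a b u v : seg a b v - seg a b u = (v - u) *: (b - a).
Proof. by apply/rowP => i; rewrite !mxE; ring. Qed.

Definition seg_closed (K : set 'rV[R]_p) :=
  forall a b t, K a -> K b -> 0 <= t -> t <= 1 -> K (seg a b t).

Lemma within_dot_seg (K : set 'rV[R]_p) q a b w :
  seg_closed K -> {within K, continuous q} -> K a -> K b ->
  {within `[0, 1], continuous (fun t => dot (q (seg a b t)) w)}.
Proof.
move=> cK /within_continuousP cq Ka Kb; apply/within_continuousP => t.
rewrite /= in_itv /= => /andP[t0 t1] e e0.
set C := p%:R * `|w| + 1.
have C0 : 0 < C by rewrite ltr_wpDl.
have [d d0 qd] := cq _ (cK _ _ _ Ka Kb t0 t1) (e / C) (divr_gt0 e0 C0).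
set D := `|b - a| + 1.
have D0 : 0 < D by rewrite ltr_wpDl.
exists (d / D); first exact: divr_gt0.
move=> s; rewrite in_itv /= => /andP[s0 s1] st.
rewrite -dotNl -dotDl (le_lt_trans (dot_norm_le _ _))//.
have := qd _ (cK _ _ _ Ka Kb s0 s1).
rewrite segB normrZ => /(_ _)/wrap[].
  rewrite ltr_pdivlMr// in st; apply: le_lt_trans st.
  by rewrite ler_wpM2l// lerDl.
rewrite ltr_pdivlMr// => qe; apply: le_lt_trans qe.
by rewrite mulrCA ler_wpM2l// lerDl.
Qed.

Lemma is_derive_dot_seg q a b w t : differentiable q (seg a b t) ->
  is_derive t 1 (fun t => dot (q (seg a b t)) w)
    (dot ((b - a) *m 'J q (seg a b t)) w).
Proof.
move=> dq; apply: is_derive1_approx => e e0.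
set C := p%:R * (`|b - a| * `|w|) + 1.
have C0 : 0 < C by rewrite ltr_wpDl// !mulr_ge0.
have [d d0 qd] := jacobian_approx dq _ (divr_gt0 e0 C0).
set D := `|b - a| + 1.
have D0 : 0 < D by rewrite ltr_wpDl.
exists (d / D); first exact: divr_gt0.
move=> h hd; have := qd (seg a b (t + h)).
rewrite segB (addrC t) addrK normrZ => /(_ _)/wrap[].
  rewrite ltr_pdivlMr// in hd; apply: le_lt_trans hd.
  by rewrite ler_wpM2l// lerDl.
move=> qh; rewrite -dotZl -!dotNl -!dotDl (le_trans (dot_norm_le _ _))//.
rewrite -scalemxAl in qh.
apply: (@le_trans _ _ (p%:R * ((e / C * (`|h| * `|b - a|)) * `|w|))).
  by rewrite ler_wpM2l// ler_wpM2r.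
have -> : p%:R * ((e / C * (`|h| * `|b - a|)) * `|w|) =
   (e * `|h|) * ((p%:R * (`|b - a| * `|w|)) / C) by ring.
rewrite ler_piMr// ?mulr_ge0 ?(ltW e0)//.
by rewrite ler_pdivrMr// mul1r lerDl.
Qed.

(** For symmetric [M] this is a potential of the affine field [c0 + (y - x0) *m M]. With [c0 = q x0]
    and [M = 'J q x0] that field is the first-order expansion of [q] at [x0]. *)
Definition quad (x0 c0 : 'rV[R]_p) (M : 'M[R]_p) y : R :=
  dot c0 y + 2^-1 * dot ((y - x0) *m M) (y - x0).

Lemma is_derive_quad_seg x0 c0 M a b t : M^T = M ->
  is_derive t 1 (fun t => quad x0 c0 M (seg a b t))
    (dot (c0 + (seg a b t - x0) *m M) (b - a)).
Proof.
move=> MT; apply: is_derive1_approx => e e0.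
set d := b - a; set k := dot (d *m M) d.
have C0 : 0 < `|k| + 1 by rewrite ltr_wpDl.
exists (e / (`|k| + 1)); first exact: divr_gt0.
move=> h hd; have -> : seg a b (t + h) = seg a b t + h *: d.
  by rewrite /seg scalerDl addrA.
set y := seg a b t.
(* The remainder is exactly quadratic in [h], because symmetry of [M] merges the two cross terms. *)
have -> : quad x0 c0 M (y + h *: d) - quad x0 c0 M y -
    h * dot (c0 + (y - x0) *m M) d = 2^-1 * h * k * h.
  rewrite /quad (addrAC y) /k; move: (y - x0) (d) => z d'.
  rewrite mulmxDl -scalemxAl !dot_lin (dot_sym M d' z)//.
  by field.
rewrite normrM ler_wpM2r// -mulrA normrM gtr0_norm ?invr_gt0//.
rewrite normrM; rewrite ltr_pdivlMr// in hd.
have h1 : `|h| * `|k| <= e by apply: le_trans (ltW hd); rewrite ler_wpM2l// lerDl.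
have := mulr_ge0 (normr_ge0 h) (normr_ge0 k).
move: h1; set z := `|h| * `|k|; lra.
Qed.

Lemma within_quad_seg x0 c0 M a b : M^T = M ->
  {within `[0, 1], continuous (fun t => quad x0 c0 M (seg a b t))}.
Proof.
move=> MT; apply: continuous_subspaceT => t.
have [dq _] := @is_derive_quad_seg x0 c0 M a b t MT.
exact/differentiable_continuous/derivable1_diffP.
Qed.

End Segment.

(** * Line integrals along segments, computed through primitives *)

Lemma ex_primitive01 {R : realType} {f : R -> R} :
  {within `[0, 1], continuous f} ->
  exists F : R -> R, {within `[0, 1], continuous F} /\
    forall t : R, t \in `]0, 1[ -> is_derive t 1 F (f t).
Proof.
move=> cf.
have fi : lebesgue_measure.-integrable `[0, 1] (EFin \o f).
  by apply: continuous_compact_integrable => //; exact: segment_compact.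
exists (fun x => parameterized_integral lebesgue_measure 0 x f); split.
  exact: parameterized_integral_continuous.
move=> t t01; have ct : {for t, continuous f}.
  exact: (within_continuous_continuous ltr01 cf t01).
move: t01; rewrite in_itv/= => /andP[t0 t1].
have [dF FE] := continuous_FTC1_closed t1 fi t0 ct.
by apply: DeriveDef; [exact: dF|rewrite -derive1E].
Qed.

Section LineIntegral.
Context {R : realType} {p : nat} (q : 'rV[R]_p -> 'rV[R]_p).
Implicit Types (a b c : 'rV[R]_p) (F : R -> R).

Definition line_integral a b : R :=
  \int[lebesgue_measure]_(t in `[0, 1]) dot (q (seg a b t)) (b - a).

(** An antiderivative of the integrand; it turns reversal and additivity of line integrals into
    identities between values of [F]. *)
Definition line_primitive a b F :=
  {within `[0, 1], continuous F} /\
  forall t : R, t \in `]0, 1[ -> is_derive t 1 F (dot (q (seg a b t)) (b - a)).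

Variable K : set 'rV[R]_p.
Hypothesis segK : seg_closed K.
Hypothesis cq : {within K, continuous q}.

Lemma ex_line_primitive a b : K a -> K b -> exists F, line_primitive a b F.
Proof.
move=> Ka Kb.
exact: ex_primitive01 (within_dot_seg _ _ _ _ (b - a) segK cq Ka Kb).
Qed.

Lemma line_integralE a b F : K a -> K b -> line_primitive a b F ->
  line_integral a b = F 1 - F 0.
Proof.
move=> Ka Kb [cF dF]; rewrite /line_integral /Rintegral.
rewrite (@continuous_FTC2 _ _ F)//.
- exact: within_dot_seg Ka Kb.
- have /(continuous_within_itvP _ (@ltr01 R))[? ? ?] := cF.
  by split=> // t t01; have [] := dF t t01.
- by move=> t t01; have [? dv] := dF t t01; rewrite derive1E.
Qed.

(** By the chain rule, [F] composed with the affine map sending 0 to [u] and 1 to [v] is a primitive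
    along the subsegment. The case [u > v] is included and gives orientation reversal. *)
Lemma line_integral_seg a b F u v : K a -> K b -> line_primitive a b F ->
  0 <= u <= 1 -> 0 <= v <= 1 -> u != v ->
  line_integral (seg a b u) (seg a b v) = F v - F u.
Proof.
move=> Ka Kb [cF dF] /andP[u0 u1] /andP[v0 v1] uv.
have Ku : K (seg a b u) by apply: segK.
have Kv : K (seg a b v) by apply: segK.
rewrite (@line_integralE _ _ (fun t => F (u + t * (v - u))))//.
  by rewrite mul1r mul0r addr0 (addrC u) subrK.
split.
  move/within_continuousP : cF => cF; apply/within_continuousP => t.
  rewrite /= in_itv/= => /andP[t0 t1] e e0.
  have [|d d0 Fd] := cF (u + t * (v - u)) _ e e0.
    by rewrite /= in_itv/=; apply/andP; split; nra.
  have D0 : 0 < `|v - u| by rewrite normr_gt0 subr_eq0 eq_sym.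
  exists (d / `|v - u|); first exact: divr_gt0.
  move=> s; rewrite /= in_itv/= => /andP[s0 s1] st; apply: Fd.
    by rewrite /= in_itv/=; apply/andP; split; nra.
  have -> : u + s * (v - u) - (u + t * (v - u)) = (s - t) * (v - u) by ring.
  by rewrite normrM -ltr_pdivlMr.
move=> t; rewrite in_itv/= => /andP[t0 t1].
have uvt : u + t * (v - u) \in `]0, 1[.
  rewrite in_itv/=; move/eqP: uv => uv; apply/andP.
  have [uv'|uv'|//] := ltgtP u v; split; nra.
have dFt := dF _ uvt.
rewrite seg_seg segB dotZr.
have dg : is_derive t 1 (fun t => u + t * (v - u)) (v - u).
  apply: is_derive1_approx => e e0; exists 1 => // h _.
  have -> : u + (t + h) * (v - u) - (u + t * (v - u)) - h * (v - u) = 0 by ring.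
  by rewrite normr0 mulr_ge0// ltW.
by rewrite mulrC; exact: (@is_derive1_comp R F (fun t => u + t * (v - u)) t).
Qed.

Lemma line_integral_opp a b : K a -> K b ->
  line_integral b a = - line_integral a b.
Proof.
move=> Ka Kb; have [F FP] := ex_line_primitive _ _ Ka Kb.
have := line_integral_seg _ _ _ 1 0 Ka Kb FP.
rewrite seg0 seg1 (@line_integralE a b F)// opprB; apply; rewrite ?lexx ?ler01//.
Qed.

Lemma line_integral_midpoint a b : K a -> K b ->
  line_integral a b =
  line_integral a (seg a b 2^-1) + line_integral (seg a b 2^-1) b.
Proof.
move=> Ka Kb; have [F FP] := ex_line_primitive _ _ Ka Kb.
have h01 : 0 <= (2^-1 : R) <= 1 by apply/andP; split; lra.
have h00 : 0 <= (0 : R) <= 1 by rewrite ler01 lexx.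
have h11 : 0 <= (1 : R) <= 1 by rewrite ler01 lexx.
have h0 : (0 : R) != 2^-1 by apply/negbT/lt_eqF; lra.
have h1 : (2^-1 : R) != 1 by apply/negbT/lt_eqF; lra.
have := line_integral_seg _ _ _ _ _ Ka Kb FP h00 h01 h0.
have := line_integral_seg _ _ _ _ _ Ka Kb FP h01 h11 h1.
rewrite seg0 seg1 (@line_integralE a b F)// => -> ->; ring.
Qed.

(** Mean value theorem for a primitive minus the quadratic potential along the segment. It turns a
    pointwise bound on the difference of the two fields into a bound on the difference of their
    integrals. *)
Lemma line_integral_mean x0 c0 (M : 'M[R]_p) a b : M^T = M -> K a -> K b ->
  exists2 t : R, 0 <= t <= 1 &
  line_integral a b - (quad x0 c0 M b - quad x0 c0 M a) =
  dot (q (seg a b t) - (c0 + (seg a b t - x0) *m M)) (b - a).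
Proof.
move=> MT Ka Kb; have [F FP] := ex_line_primitive _ _ Ka Kb.
rewrite (@line_integralE _ _ F)//; case: FP => cF dF.
pose G := F - (fun t => quad x0 c0 M (seg a b t)).
have [||t t01 GE] := @MVT R G (fun t => dot (q (seg a b t)) (b - a) -
   dot (c0 + (seg a b t - x0) *m M) (b - a)) 0 1 ltr01.
- move=> t t01; apply: is_deriveB; first exact: dF.
  exact: is_derive_quad_seg.
- move=> t; apply: (continuousD (cF t)); apply: continuousN.
  exact: within_quad_seg.
exists t; first by move: t01; rewrite in_itv/= => /andP[/ltW-> /ltW->].
rewrite dotDl dotNl -[RHS]mulr1 -[X in _ * X](subr0 1) -GE /G !fctE seg1 seg0.
ring.
Qed.

End LineIntegral.

(** * Goursat's argument on triangles and cyclic monotonicity *)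

Lemma ex_halving_lt (R : realType) (D e : R) : 0 <= D -> 0 < e ->
  exists n : nat, D * 2^-1 ^+ n < e.
Proof.
move=> D0 e0; exists (Num.bound (D / e)).
have De : 0 <= D / e by rewrite divr_ge0 ?(ltW e0).
have := archi_boundP De; set n := Num.bound _ => Dn.
rewrite exprVn ltr_pdivrMr ?exprn_gt0// mulrC -ltr_pdivrMr//.
apply: (lt_le_trans Dn); rewrite -natrX ler_nat; exact/ltnW/ltn_expl.
Qed.

Lemma within_differentiable {R : realType} {V W : normedModType R}
    (K : set V) (f : V -> W) :
  (forall x, K x -> differentiable f x) -> {within K, continuous f}.
Proof.
move=> df; apply: continuous_in_subspaceT => x /set_mem Kx.
exact/differentiable_continuous/df.
Qed.

Lemma pigeonhole4 {R : realDomainType} (x y z t : R) :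
  [\/ `|x + y + z + t| <= 4 * `|x|, `|x + y + z + t| <= 4 * `|y|,
     `|x + y + z + t| <= 4 * `|z| | `|x + y + z + t| <= 4 * `|t|].
Proof.
have h : `|x + y + z + t| <= `|x| + `|y| + `|z| + `|t|.
  by do 2!(rewrite (le_trans (ler_normD _ _))// lerD//); rewrite ler_normD.
case: (leP (`|x + y + z + t|) (4 * `|x|)) => hx; first exact: Or41.
case: (leP (`|x + y + z + t|) (4 * `|y|)) => hy; first exact: Or42.
case: (leP (`|x + y + z + t|) (4 * `|z|)) => hz; first exact: Or43.
apply: Or44; lra.
Qed.

Section Goursat.
Context {R : realType} {p : nat} (q : 'rV[R]_p -> 'rV[R]_p) (K : set 'rV[R]_p).
Implicit Types (a b c x : 'rV[R]_p).
Hypothesis compactK : compact K.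
Hypothesis segK : seg_closed K.
Hypothesis dq : forall x, K x -> differentiable q x.
Hypothesis symJ : forall x, K x -> ('J q x)^T = 'J q x.

Let cq : {within K, continuous q} := within_differentiable K q dq.

Local Notation I := (line_integral q).

Definition circulation a b c := I a b + I b c + I c a.

(** The midpoints cut the triangle into four of half the size. Each inner edge is traversed once in
    each direction, so the four circulations add up to the original one and one of them carries at
    least a quarter of it. *)
Lemma subtriangle a b c (r : R) : K a -> K b -> K c ->
  `|b - a| <= r -> `|c - b| <= r -> `|a - c| <= r ->
  exists a' b' c', [/\ [/\ K a', K b' & K c'],
    [/\ `|b' - a'| <= r / 2, `|c' - b'| <= r / 2 & `|a' - c'| <= r / 2],
    `|circulation a b c| <= 4 * `|circulation a' b' c'| & `|a' - a| <= r].
Proof.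
move=> Ka Kb Kc ab bc ca.
have h0 : (0 : R) <= 2^-1 by rewrite invr_ge0.
have h1 : 2^-1 <= (1 : R) by lra.
set m := seg a b 2^-1; set n := seg b c 2^-1; set o := seg c a 2^-1.
have Km : K m by exact: segK.
have Kn : K n by exact: segK.
have Ko : K o by exact: segK.
have r0 : 0 <= r := le_trans (normr_ge0 _) ab.
have r2 : r / 2 <= r by rewrite ler_pdivrMr// ler_peMr// ler1n.
have half u v w : u - v = 2^-1 *: w -> `|w| <= r -> `|u - v| <= r / 2.
  by move=> -> wr; rewrite normrZ ger0_norm// mulrC ler_wpM2r.
have ma : `|m - a| <= r / 2.
  by apply: half ab; apply/rowP => i; rewrite !mxE; field.
have bm : `|b - m| <= r / 2.
  by apply: half ab; apply/rowP => i; rewrite !mxE; field.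
have nb : `|n - b| <= r / 2.
  by apply: half bc; apply/rowP => i; rewrite !mxE; field.
have cn : `|c - n| <= r / 2.
  by apply: half bc; apply/rowP => i; rewrite !mxE; field.
have oc : `|o - c| <= r / 2.
  by apply: half ca; apply/rowP => i; rewrite !mxE; field.
have ao : `|a - o| <= r / 2.
  by apply: half ca; apply/rowP => i; rewrite !mxE; field.
have mo : `|o - m| <= r / 2.
  by apply: half bc; apply/rowP => i; rewrite !mxE; field.
have nm : `|m - n| <= r / 2.
  by apply: half ca; apply/rowP => i; rewrite !mxE; field.
have on : `|n - o| <= r / 2.
  by apply: half ab; apply/rowP => i; rewrite !mxE; field.
have sumE : circulation a b c = circulation a m o + circulation m b n +
    circulation o n c + circulation m n o.
  rewrite /circulation (line_integral_midpoint q _ segK cq a b)//.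
  rewrite (line_integral_midpoint q _ segK cq b c)//.
  rewrite (line_integral_midpoint q _ segK cq c a)//.
  rewrite -/m -/n -/o.
  rewrite (line_integral_opp q _ segK cq m o)//.
  rewrite (line_integral_opp q _ segK cq m n)//.
  rewrite (line_integral_opp q _ segK cq n o)//.
  move: (I a m) (I m b) (I b n) (I n c) (I c o) (I o a) (I m o) (I m n) (I n o).
  by move=> *; ring.
have := pigeonhole4 (circulation a m o) (circulation m b n) (circulation o n c)
  (circulation m n o); rewrite -sumE.
case=> h.
- by exists a, m, o; split => //; last by rewrite subrr normr0.
- by exists m, b, n; split => //; exact: le_trans ma r2.
- exists o, n, c; split => //.
  by rewrite distrC (le_trans ao).
- rewrite distrC in mo; rewrite distrC in nm; rewrite distrC in on.
  by exists m, n, o; split; [split|split|exact: h|exact: le_trans ma r2].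
Qed.

(** The potential integrates the first-order expansion of [q] at [x] exactly, so only the
    linearisation error, at most [e * r] on the segment, remains. *)
Lemma line_integral_approx x u v (e d r : R) : K x -> K u -> K v -> r < d ->
  0 < e -> `|u - x| <= r -> `|v - x| <= r ->
  (forall y, `|y - x| < d -> `|q y - q x - (y - x) *m 'J q x| <= e * `|y - x|) ->
  `|I u v - (quad x (q x) ('J q x) v - quad x (q x) ('J q x) u)|
    <= p%:R * (e * r * `|v - u|).
Proof.
move=> Kx Ku Kv rd e0 ur vr qe.
have [t /andP[t0 t1] ->] :=
  line_integral_mean q K segK cq x (q x) _ u v (symJ x Kx) Ku Kv.
have sr : `|seg u v t - x| <= r.
  have -> : seg u v t - x = (1 - t) *: (u - x) + t *: (v - x).
    by apply/rowP => i; rewrite !mxE; ring.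
  rewrite (le_trans (ler_normD _ _))// !normrZ (ger0_norm t0) ger0_norm ?subr_ge0//.
  have -> : r = (1 - t) * r + t * r by ring.
  by rewrite lerD// ler_wpM2l// subr_ge0.
rewrite (le_trans (dot_norm_le _ _))// ler_wpM2l// ler_wpM2r// opprD addrA.
apply: (le_trans (qe _ (le_lt_trans sr rd))).
by rewrite ler_wpM2l// ltW.
Qed.

Lemma circulation_eq0 a b c : K a -> K b -> K c -> circulation a b c = 0.
Proof.
move=> Ka Kb Kc; apply: contrapT => /eqP; rewrite -normr_gt0.
set g := `|circulation a b c| => g0.
pose V := 'rV[R]_p.
pose D := `|b - a| + `|c - b| + `|a - c|.
have D0 : 0 <= D by rewrite !addr_ge0.
pose r n := D * 2^-1 ^+ n.
have rS n : r n.+1 = r n / 2 by rewrite /r exprSr mulrA.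
have r_ge0 n : 0 <= r n by rewrite mulr_ge0// exprn_ge0// invr_ge0.
pose P n (T : V * V * V) :=
  [/\ [/\ K T.1.1, K T.1.2 & K T.2],
  [/\ `|T.1.2 - T.1.1| <= r n, `|T.2 - T.1.2| <= r n & `|T.1.1 - T.2| <= r n] &
  g <= 4 ^+ n * `|circulation T.1.1 T.1.2 T.2|].
pose Q n (T T' : V * V * V) := P n.+1 T' /\ `|T'.1.1 - T.1.1| <= r n.
have PQ n T : P n T -> exists T', Q n T T'.
  move=> [[K1 K2 K3] [h1 h2 h3] gT].
  have [a' [b' [c' [hK hr hc ha]]]] := subtriangle _ _ _ _ K1 K2 K3 h1 h2 h3.
  exists (a', b', c'); split; last exact: ha.
  split; [exact: hK|by rewrite rS|].
  apply: (le_trans gT); rewrite exprSr -mulrA ler_wpM2l// exprn_ge0//.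
pose T := fix T n := if n is m.+1 then xget (T m) (Q m (T m)) else (a, b, c).
have PT n : P n (T n).
  elim: n => [|n IH].
    split=> //=; rewrite /r ?expr0 ?mulr1 ?mul1r//.
    rewrite /D; have := normr_ge0 (b - a); have := normr_ge0 (c - b).
    by have := normr_ge0 (a - c); split; lra.
  have [T' QT'] := PQ n _ IH.
  by have [] := xgetI (T n) QT'.
have QT n : `|(T n.+1).1.1 - (T n).1.1| <= r n.
  have [T' QT'] := PQ n _ (PT n).
  by have [] := xgetI (T n) QT'.
pose s n := (T n).1.1.
(* Geometric sum of the displacements: [r n + ... + r (n + k - 1) = 2 * (r n - r (n + k))]. *)
have sk n k : `|s (n + k)%N - s n| <= 2 * (r n - r (n + k)%N).
  elim: k => [|k IH]; first by rewrite addn0 !subrr normr0 mulr0.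
  rewrite addnS rS.
  have -> : s (n + k).+1 - s n = (s (n + k).+1 - s (n + k)%N) + (s (n + k)%N - s n).
    by rewrite addrA subrK.
  rewrite (le_trans (ler_normD _ _))//.
  by have := QT (n + k)%N; rewrite -/(s _) -/(s _); move: IH; lra.
have Ks n : K (s n) by have [[]] := PT n.
have [x [Kx clx]] : K `&` cluster (s @ \oo) !=set0.
  by apply: compactK; exists 0%N => // n _ /=; exact: Ks.
have sx n : `|s n - x| <= 2 * r n.
  apply/ler_addgt0Pr => e e0.
  have [y [[m /= nm <-] xy]] : ((s @` [set m | (n <= m)%N]) `&` ball x e) !=set0.
    apply: clx; last exact: nbhsx_ballx.
    by exists n => // m /= nm; exists m.
  have -> : s n - x = - (s m - s n) + (s m - x) by rewrite opprB addrA subrK.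
  rewrite (le_trans (ler_normD _ _))// normrN lerD//.
    have := sk n (m - n)%N; rewrite subnKC// => h; apply: (le_trans h).
    by rewrite ler_wpM2l// lerBlDr lerDl.
  by rewrite distrC ltW//; move: xy; rewrite -ball_normE.
(* The 9 counts three edges, each with linearisation error taken within [3 * r n] of [x]; the [+ 1]
   makes the final bound [p%:R * (9 * D ^+ 2) * e] strictly less than [g]. *)
pose C := p%:R * (9 * D ^+ 2) + 1.
have C0 : 0 < C by rewrite ltr_wpDl// !mulr_ge0.
pose e := g / C.
have e0 : 0 < e by rewrite divr_gt0.
have [d d0 qd] := jacobian_approx (dq x Kx) e e0.
have [n rn] := @ex_halving_lt R (3 * D) d (mulr_ge0 (ler0n _ 3) D0) d0.
have {}rn : 3 * r n < d by rewrite /r mulrA.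
have [[Ka' Kb' Kc'] [ab bc ca] gn] := PT n.
move: (sx n) Ka' Kb' Kc' ab bc ca gn; rewrite /s.
move: (T n) => [[a' b'] c'] /= ax Ka' Kb' Kc' ab bc ca gn.
(* The first vertex is within [2 * r n] of [x], and the other two are at most one edge length [r n]
   further. *)
have ax3 : `|a' - x| <= 3 * r n.
  by apply: (le_trans ax); rewrite ler_wpM2r// ler_nat.
have bx3 : `|b' - x| <= 3 * r n.
  have -> : b' - x = (b' - a') + (a' - x) by rewrite addrA subrK.
  by rewrite (le_trans (ler_normD _ _))// -[3]/(1 + 2)%:R natrD mulrDl mul1r lerD.
have cx3 : `|c' - x| <= 3 * r n.
  have -> : c' - x = - (a' - c') + (a' - x) by rewrite opprB addrA subrK.
  by rewrite (le_trans (ler_normD _ _))// normrN -[3]/(1 + 2)%:R natrD mulrDl mul1r lerD.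
pose B := p%:R * (e * (3 * r n) * r n).
have est u v : K u -> K v -> `|u - x| <= 3 * r n -> `|v - x| <= 3 * r n ->
    `|v - u| <= r n ->
    `|I u v - (quad x (q x) ('J q x) v - quad x (q x) ('J q x) u)| <= B.
  move=> Ku Kv ux vx uv.
  apply: (le_trans (line_integral_approx x u v e d _ Kx Ku Kv rn e0 ux vx qd)).
  rewrite ler_wpM2l// ler_wpM2l//; apply: mulr_ge0; first exact: ltW.
  exact: mulr_ge0.
have cB : `|circulation a' b' c'| <= B + B + B.
  (* The increments of the potential [L] cancel around the closed triangle. *)
  pose L := quad x (q x) ('J q x).
  have -> : circulation a' b' c' = (I a' b' - (L b' - L a')) +
      (I b' c' - (L c' - L b')) + (I c' a' - (L a' - L c')).
    rewrite /circulation; move: (I a' b') (I b' c') (I c' a') (L a') (L b') (L c').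
    by move=> *; ring.
  rewrite (le_trans (ler_normD _ _))// lerD//; last exact: est.
  by rewrite (le_trans (ler_normD _ _))// lerD//; exact: est.
have : g <= p%:R * (9 * D ^+ 2) * e.
  apply: (le_trans gn); apply: (@le_trans _ _ (4 ^+ n * (B + B + B))).
    by rewrite ler_wpM2l// exprn_ge0.
  (* The factor [4 ^+ n] is absorbed by the two factors [r n] in [B], each of which carries
     [2^-1 ^+ n]. *)
  have -> : 4 ^+ n * (B + B + B) =
     p%:R * (9 * D ^+ 2) * e * (4 * (2^-1 * 2^-1)) ^+ n.
    by rewrite !exprMn /B /r; ring.
  have -> : 4 * (2^-1 * 2^-1) = 1 :> R by field.
  by rewrite expr1n mulr1.
apply/negP; rewrite -ltNge /e mulrCA -ltr_pdivlMl// mulVf ?gt_eqF//.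
by rewrite ltr_pdivrMr// mul1r /C ltrDl.
Qed.

Hypothesis posJ : forall x v, K x -> 0 <= dot (v *m 'J q x) v.

Lemma monotone_psd_jacobian u v : K u -> K v -> 0 <= dot (q v - q u) (v - u).
Proof.
move=> Ku Kv.
have [||t] := @MVT R (fun t => dot (q (seg u v t)) (v - u))
  (fun t => dot ((v - u) *m 'J q (seg u v t)) (v - u)) 0 1 ltr01.
- move=> t; rewrite in_itv/= => /andP[t0 t1]; apply: is_derive_dot_seg.
  by apply: dq; apply: segK => //; exact: ltW.
- exact: within_dot_seg Ku Kv.
rewrite in_itv/= => /andP[t0 t1].
rewrite seg0 seg1 subr0 mulr1 dotDl dotNl => ->.
by apply: posJ; apply: segK => //; exact: ltW.
Qed.

(** The integral equals the integrand at some point of the segment, and monotonicity makes the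
    integrand largest at [v]. *)
Lemma line_integral_le u v : K u -> K v -> I u v <= dot (q v) (v - u).
Proof.
move=> Ku Kv.
have [t /andP[t0 t1]] :=
  line_integral_mean q K segK cq 0 0 0 u v (trmx0 _ _ _) Ku Kv.
rewrite /quad !mulmx0 !dot0l !mulr0 !addr0 subrr !subr0 => ->.
move: t1; rewrite le_eqVlt => /predU1P[->|t1]; first by rewrite seg1.
have := monotone_psd_jacobian _ _ (segK _ _ _ Ku Kv t0 (ltW t1)) Kv.
have -> : v - seg u v t = (1 - t) *: (v - u) by rewrite -segB seg1.
rewrite dotZr pmulr_rge0 ?subr_gt0//.
by rewrite dotDl dotNl subr_ge0.
Qed.

(** Each term dominates the integral along the edge arriving at its point, and the three integrals
    form a closed circulation, which is zero. *)
Lemma cyclic_monotone3 a b c : K a -> K b -> K c ->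
  0 <= dot (q a) (a - b) + dot (q b) (b - c) + dot (q c) (c - a).
Proof.
move=> Ka Kb Kc; rewrite -(circulation_eq0 _ _ _ Ka Kc Kb) /circulation.
have -> : I a c + I c b + I b a = I b a + I c b + I a c by rewrite addrC addrA addrAC.
by rewrite !lerD// line_integral_le.
Qed.

End Goursat.

(** * Convex sets: limits along segments, projection, interior *)

Lemma convex_set_seg_closed {R : realType} {p : nat} {U : set 'rV[R]_p} :
  convex_set (U : set (convex_lmodType 'rV[R]_p)) -> seg_closed U.
Proof.
move=> cU a b t Ua Ub t0 t1.
have := cU b a (Itv01 t0 t1) (mem_set Ub) (mem_set Ua) => /set_mem.
rewrite segE addrC; exact.
Qed.

Lemma within01_lim1_ge {R : realType} (h : R -> R) (c : R) :
  {within `[0, 1], continuous h} ->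
  (forall t : R, 0 < t -> t < 1 -> c <= h t) -> c <= h 1.
Proof.
move=> /within_continuousP ch hc; rewrite leNgt; apply/negP => h1.
have h1' : 0 < c - h 1 by rewrite subr_gt0.
have [|d d0 hd] := ch 1 _ (c - h 1) h1'; first by rewrite /= in_itv/= ler01 lexx.
pose s := Num.min (d / 2) (1 / 2).
have s0 : 0 < s by rewrite lt_min !divr_gt0.
have sd : s < d by rewrite gt_min; apply/orP; left; lra.
have s1 : s < 1 by rewrite gt_min; apply/orP; right; lra.
have [t0 t1] : 0 < 1 - s /\ 1 - s < 1 by lra.
have := hd (1 - s); rewrite /= in_itv/= !ltW// => /(_ isT).
rewrite (_ : 1 - s - 1 = - s); last by ring.
rewrite normrN gtr0_norm// => /(_ sd); rewrite ltr_norml => /andP[_ ht].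
have := hc _ t0 t1; lra.
Qed.

Section InnerProduct.
Context {R : realType} {p : nat}.
Implicit Types (u v w y : 'rV[R]_p) (U : set 'rV[R]_p).

Lemma continuous_dot_sqr y : continuous (fun v => dot (v - y) (v - y)).
Proof.
move=> u; apply/continuous_atP => e e0.
set B := p%:R * (1 + 2 * `|u - y|) + 1.
have B0 : 0 < B by rewrite ltr_wpDl// mulr_ge0// addr_ge0// mulr_ge0.
exists (Num.min 1 (e / B)); first by rewrite lt_min ltr01 divr_gt0.
move=> v; rewrite lt_min => /andP[v1]; rewrite ltr_pdivlMr// => ve.
have -> : dot (v - y) (v - y) - dot (u - y) (u - y) =
    dot (v - u) ((v - u) + 2 *: (u - y)).
  have -> : v - y = (v - u) + (u - y) by rewrite addrA subrK.
  move: (v - u) (u - y) => h k; rewrite !dot_lin (dotC k h); ring.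
apply: le_lt_trans ve; rewrite (le_trans (dot_norm_le _ _))//.
rewrite mulrCA ler_wpM2l// /B ler_wpDr// ler_wpM2l//.
by rewrite (le_trans (ler_normD _ _))// normrZ ger0_norm// lerD// ltW.
Qed.

Lemma dot_sqrD u v : dot (u + v) (u + v) = dot u u + 2 * dot u v + dot v v.
Proof. rewrite !dot_lin (dotC v u); ring. Qed.

Lemma dot_sqrD_le u v : dot (u + v) (u + v) <= 2 * dot u u + 2 * dot v v.
Proof.
have := dot_ge0 (u - v); rewrite !dot_sqrD !dot_lin; lra.
Qed.

Lemma ex_projection U w : U !=set0 -> compact U -> seg_closed U ->
  exists2 u, U u &
    (forall v, U v -> dot (u - w) (u - w) <= dot (v - w) (v - w)) /\
    (forall v, U v -> dot (w - u) (v - u) <= 0).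
Proof.
move=> U0 cU segU.
have [|u /set_mem Uu umin] :=
    @compact_EVT_min _ R (fun v => dot (v - w) (v - w)) U U0 cU.
  exact/continuous_subspaceT/continuous_dot_sqr.
exists u => //; split=> v Uv; first by apply: umin; exact: mem_set.
rewrite leNgt; apply/negP => h0.
set h := dot (w - u) (v - u) in h0.
set k := dot (v - u) (v - u).
have k0 : 0 <= k := dot_ge0 _.
(* With this [t] one has [t * k < 2 * h], so moving from [u] towards [v] by [t] changes the squared
   distance to [w] by [t * (t * k - 2 * h) < 0]. *)
pose t := h / (h + k).
have hk : 0 < h + k by rewrite ltr_pwDl.
have t0 : 0 < t by rewrite divr_gt0.
have t1 : t <= 1 by rewrite ler_pdivrMr// mul1r lerDl.
have := umin _ (mem_set (segU _ _ _ Uu Uv (ltW t0) t1)).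
have -> : seg u v t - w = (u - w) + t *: (v - u) by rewrite /seg addrAC.
have e1 : dot (u - w) (t *: (v - u)) = - (t * h).
  by rewrite -(opprB w u) dotNl dotZr.
rewrite (dot_sqrD (u - w)) e1 dotZl dotZr -/k => hh.
have : t * k < 2 * h.
  have : t * k <= k by rewrite ler_piMl.
  have : t * (h + k) = h by rewrite divfK ?gt_eqF.
  rewrite mulrDr => tE _; have := mulr_gt0 t0 h0; lra.
rewrite -(ltr_pM2l t0); move: hh; lra.
Qed.

End InnerProduct.

Section Interior.
Context {R : realType} {p : nat} {U : set 'rV[R]_p}.
Hypothesis segU : seg_closed U.

(** The homothety of centre [u] and ratio [1 - t] maps a ball around [z] onto a ball around
    [seg z u t], and convexity keeps its image inside [U]. *)
Lemma interior_seg z u (t : R) : interior U z -> U u -> 0 <= t -> t < 1 ->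
  interior U (seg z u t).
Proof.
move=> /interiorP[d d0 Ud] Uu t0 t1; apply/interiorP.
have t1' : 0 < 1 - t by rewrite subr_gt0.
exists ((1 - t) * d); first exact: mulr_gt0.
move=> y yd; pose z' := z + (1 - t)^-1 *: (y - seg z u t).
have -> : y = seg z' u t.
  rewrite segE /z' scalerDr scalerA divff ?gt_eqF// scale1r addrAC -segE.
  by rewrite addrC subrK.
apply: segU => //; last exact: ltW.
apply: Ud; rewrite /z' addrAC subrr add0r normrZ gtr0_norm ?invr_gt0//.
by rewrite mulrC ltr_pdivrMr// mulrC.
Qed.

(** For interior [z] and [0 <= t < 1] this shrunken copy of [U] lies in the interior, where [q] is
    differentiable; it serves as the set [K] of Goursat's argument. *)
Lemma seg_image_closed z (t : R) : seg_closed ((fun u => seg z u t) @` U).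
Proof.
move=> _ _ s [a Ua <-] [b Ub <-] s0 s1; exists (seg a b s); first exact: segU.
by apply/rowP => i; rewrite !mxE; ring.
Qed.

Lemma compact_seg_image z (t : R) : compact U ->
  compact ((fun u => seg z u t) @` U).
Proof.
apply: continuous_compact; apply: continuous_subspaceT => u.
apply/continuous_atP => e e0; pose B := `|t| + 1.
have B0 : 0 < B by rewrite ltr_wpDl.
exists (e / B); first exact: divr_gt0.
move=> v; rewrite ltr_pdivlMr// => ve.
have -> : seg z v t - seg z u t = t *: (v - u).
  by apply/rowP => i; rewrite !mxE; ring.
by rewrite normrZ; apply: le_lt_trans ve; rewrite mulrC ler_wpM2l// lerDl.
Qed.

End Interior.

(** * Injectivity, and interior points going to interior points *)

Section MonotoneMap.
Context {R : realType} {p : nat} {U : set 'rV[R]_p} {q : 'rV[R]_p -> 'rV[R]_p}.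
Hypothesis compactU : compact U.
Hypothesis segU : seg_closed U.
Hypothesis cq : {within U, continuous q}.
Hypothesis dq : forall x, interior U x -> differentiable q x.
Hypothesis posJ : forall x, interior U x -> sym_posdef ('J q x).

(** Mean value theorem along the segment: all its points except possibly [b] are interior, so [b]
    may lie on the boundary. *)
Lemma strict_monotone x b : interior U x -> U b -> b != x ->
  0 < dot (q b - q x) (b - x).
Proof.
move=> Ix Ub bx; have Ux := interior_subset Ix.
have [||t] := @MVT R (fun t => dot (q (seg x b t)) (b - x))
  (fun t => dot ((b - x) *m 'J q (seg x b t)) (b - x)) 0 1 ltr01.
- move=> t; rewrite in_itv/= => /andP[t0 t1]; apply: is_derive_dot_seg.
  by apply: dq; apply: interior_seg => //; exact: ltW.
- exact: within_dot_seg Ux Ub.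
rewrite in_itv/= => /andP[t0 t1].
rewrite seg0 seg1 subr0 mulr1 dotDl dotNl => ->.
have [_] := posJ _ (interior_seg segU x b t Ix Ub (ltW t0) t1).
by apply; rewrite subr_eq0.
Qed.

Lemma injective_interior x b : interior U x -> U b -> q b = q x -> b = x.
Proof.
move=> Ix Ub qbx; apply: contrapT => /eqP bx.
by have := strict_monotone _ _ Ix Ub bx; rewrite qbx subrr dot0l ltxx.
Qed.

(* A positive definite derivative has no nonzero [w] with [w *m 'J q x]
   orthogonal to [w], so the distance from [q] to [y] cannot be stationary at
   [x] unless it vanishes there. *)
Lemma interior_min_eq x y : interior U x ->
  (forall v, U v -> dot (q x - y) (q x - y) <= dot (q v - y) (q v - y)) ->
  q x = y.
Proof.
move=> Ix xmin; apply: contrapT => /eqP; rewrite -subr_eq0.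
set w := q x - y => w0.
have [_ /(_ w w0)] := posJ _ Ix; rewrite -/(dot _ _); set k := dot _ _ => k0.
pose P : R := p%:R; have P0 : 0 <= P by rewrite /P.
(* The choice of [m] keeps the linearisation error in [dot w phi] below [t * k / 4]. *)
pose m := P * `|w| ^+ 2 * 4 + 1.
have m0 : 0 < m by rewrite ltr_wpDl// !mulr_ge0// exprn_ge0.
have [d d0 qd] := jacobian_approx (dq _ Ix) (k / m) (divr_gt0 k0 m0).
have /interiorP[d' d'0 Ud] := Ix.
set J := 'J q x in k k0 qd.
pose A := `|w *m J| + k / m * `|w|.
have A0 : 0 <= A by rewrite addr_ge0// mulr_ge0// ltW// divr_gt0.
pose B := P * A ^+ 2 * 2 + 1.
have B0 : 0 < B by rewrite ltr_wpDl// !mulr_ge0// exprn_ge0.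
have W0 : 0 < `|w| + 1 by rewrite ltr_wpDl.
(* The first bound on [t] gives [dot phi phi <= t * k / 2]; the second keeps [v] within both radii
   [d] and [d']. *)
pose t := Num.min (k / B) (Num.min d d' / 2 / (`|w| + 1)).
have dd0 : 0 < Num.min d d' by rewrite lt_min d0.
have t0 : 0 < t by rewrite lt_min !divr_gt0.
have tw : t * `|w| < Num.min d d'.
  apply: (@le_lt_trans _ _ (t * (`|w| + 1))).
    by rewrite ler_wpM2l ?(ltW t0)// lerDl.
  apply: (@le_lt_trans _ _ (Num.min d d' / 2)).
    by rewrite -ler_pdivlMr// ge_min lexx orbT.
  by rewrite ltr_pdivrMr// ltr_pMr// ltr1n.
have tB : t * B <= k by rewrite -ler_pdivlMr// ge_min lexx.
have [twd twd'] : t * `|w| < d /\ t * `|w| < d'.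
  by move: tw; rewrite lt_min => /andP[].
pose v := x - t *: w.
have vx : v - x = - t *: w by rewrite /v addrAC subrr add0r scaleNr.
have nvx : `|v - x| = t * `|w| by rewrite vx normrZ normrN gtr0_norm.
have := qd v; rewrite nvx => /(_ twd); rewrite vx -scalemxAl => qv.
pose phi := q v - q x; pose err := phi - (- t) *: (w *m J).
have errE : phi = - t *: (w *m J) + err by rewrite /err addrC subrK.
have errn : `|err| <= t * (k / m * `|w|) by move: qv; rewrite mulrCA.
have phin : `|phi| <= t * A.
  rewrite errE (le_trans (ler_normD _ _))// normrZ normrN gtr0_norm//.
  by rewrite /A mulrDr lerD.
have wphi : dot w phi <= - (t * k) + t * k / 4.
  rewrite errE dotDr dotZr (dotC w (w *m J)) -/k mulNr lerD2l.
  apply: (le_trans (ler_norm _)); apply: (le_trans (dot_norm_le _ _)).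
  apply: (@le_trans _ _ (P * (`|w| * (t * (k / m * `|w|))))).
    by rewrite ler_wpM2l// ler_wpM2l.
  have -> : P * (`|w| * (t * (k / m * `|w|))) =
            t * k / 4 * ((P * `|w| ^+ 2 * 4) / m) by field; rewrite gt_eqF.
  rewrite ler_piMr//; first by rewrite !mulr_ge0// ltW.
  by rewrite ler_pdivrMr// mul1r lerDl.
have phi2 : dot phi phi <= t * k / 2.
  apply: (le_trans (ler_norm _)); apply: (le_trans (dot_norm_le _ _)).
  apply: (@le_trans _ _ (P * ((t * A) * (t * A)))).
    by rewrite ler_wpM2l// ler_pM.
  have -> : P * ((t * A) * (t * A)) = t / 2 * (t * (P * A ^+ 2 * 2)) by field.
  have -> : t * k / 2 = t / 2 * k by ring.
  rewrite ler_wpM2l ?divr_ge0 ?(ltW t0)//; apply: le_trans tB.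
  by rewrite ler_wpM2l ?(ltW t0)// lerDl.
(* The squared distance changes by [2 * dot w phi + dot phi phi], at most [- (t * k)], contradicting
   minimality at [x]. *)
have := xmin v (Ud _ _); rewrite nvx => /(_ twd').
have -> : q v - y = w + phi by rewrite /w /phi [RHS]addrC addrA subrK.
rewrite -/w dot_sqrD; have := mulr_gt0 t0 k0.
by move: wphi phi2; lra.
Qed.

(** The boundary is compact and, by injectivity, its image avoids [q x], so the squared distance has
    a positive minimum there. *)
Lemma ex_boundary_gap x : interior U x -> exists2 m : R, 0 < m &
  forall b, U b -> ~ interior U b -> m <= dot (q b - q x) (q b - q x).
Proof.
move=> Ix; pose B := U `\` interior U.
have cB : compact B.
  apply: (subclosed_compact _ compactU); last by move=> ? [].
  apply: closedI; last exact/open_closedC/open_interior.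
  by apply: compact_closed => //; exact: norm_hausdorff.
have [B0|/set0P/negP/negPn/eqP B0] := pselect (B !=set0); last first.
  (* Without boundary points any positive [m] will do. *)
  exists 1 => // b Ub nIb; have : B b by []; by rewrite B0.
have [|b /set_mem[Ub nIb] bmin] :=
    @compact_EVT_min _ R (fun b => dot (q b - q x) (q b - q x)) B B0 cB.
  have cqB : {within B, continuous q}.
    by apply: continuous_subspaceW cq => ? [].
  move=> b; apply: (@within_continuous_comp _ _ _ B q
    (fun v => dot (v - q x) (v - q x))) => //.
  by move=> v _; exact: continuous_dot_sqr.
exists (dot (q b - q x) (q b - q x)).
  apply: dot_gt0; rewrite subr_eq0; apply/eqP => qbx.
  by apply: nIb; rewrite (injective_interior _ _ Ix Ub qbx).
by move=> b' Ub' nIb'; apply: bmin; exact: mem_set.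
Qed.

Lemma image_interior_sub x : interior U x -> interior (q @` U) (q x).
Proof.
move=> Ix; have [m m0 gap] := ex_boundary_gap _ Ix.
pose B : R := p%:R * 4 + 1.
have B0 : 0 < B by rewrite ltr_wpDl// mulr_ge0.
apply/interiorP; exists (Num.min 1 (m / B)).
  by rewrite lt_min ltr01 divr_gt0.
move=> y; rewrite lt_min ltr_pdivlMr// => /andP[y1 yB].
(* The 4 arises because a minimiser [v] has [q v] no farther from [y] than [q x] is, so the squared
   distance from [q v] to [q x] is at most 2 + 2 times that from [y] to [q x]. *)
have yq : 4 * dot (y - q x) (y - q x) < m.
  apply: le_lt_trans yB; have := dot_norm_le (y - q x) (y - q x).
  move=> /(le_trans (ler_norm _)) h.
  apply: (@le_trans _ _ (4 * (p%:R * (`|y - q x| * `|y - q x|)))).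
    by rewrite ler_wpM2l.
  have -> : 4 * (p%:R * (`|y - q x| * `|y - q x|)) =
    `|y - q x| * (p%:R * 4 * `|y - q x|) by ring.
  rewrite ler_wpM2l// /B ler_wpDr// ler_piMr// ?mulr_ge0//; exact: ltW.
have U0 : U !=set0 by exists x; exact: interior_subset.
have [|v /set_mem Uv vmin] :=
    @compact_EVT_min _ R (fun v => dot (q v - y) (q v - y)) U U0 compactU.
  move=> b; apply: (@within_continuous_comp _ _ _ U q
    (fun v => dot (v - y) (v - y))) => //.
  by move=> v _; exact: continuous_dot_sqr.
have Iv : interior U v.
  apply: contrapT => nIv; have := gap _ Uv nIv.
  have -> : q v - q x = (q v - y) + (y - q x) by rewrite addrA subrK.
  have := dot_sqrD_le (q v - y) (y - q x).
  have := vmin _ (mem_set (interior_subset Ix)).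
  have -> : dot (q x - y) (q x - y) = dot (y - q x) (y - q x).
    by rewrite -opprB dotNl dotNr opprK.
  move: yq; lra.
exists v => //; apply: interior_min_eq => // v' Uv'.
by apply: vmin; exact: mem_set.
Qed.

(** * Boundary points do not go to interior points *)

Variable z : 'rV[R]_p.
Hypothesis Iz : interior U z.

(** The inequality holds on the copies of [U] shrunk towards [z] by [t < 1], which lie in the
    interior; the common factor [t] is divided out, and continuity of [q] on [U] lets [t] tend to
    1. *)
Lemma cyclic_monotone_closure a b c : U a -> U b -> U c ->
  0 <= dot (q a) (a - b) + dot (q b) (b - c) + dot (q c) (c - a).
Proof.
move=> Ua Ub Uc; have Uz := interior_subset Iz.
pose h t := dot (q (seg z a t)) (a - b) + dot (q (seg z b t)) (b - c) +
  dot (q (seg z c t)) (c - a).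
have -> : dot (q a) (a - b) + dot (q b) (b - c) + dot (q c) (c - a) = h 1.
  by rewrite /h !seg1.
have ch u w : U u ->
    {within `[0, 1], continuous (fun t => dot (q (seg z u t)) w)}.
  exact: (within_dot_seg _ _ _ _ _ segU cq Uz).
apply: within01_lim1_ge => [t|t t0 t1].
  exact: (continuousD (continuousD (ch _ _ Ua t) (ch _ _ Ub t)) (ch _ _ Uc t)).
pose K := (fun u => seg z u t) @` U.
have KI x : K x -> interior U x.
  by move=> [u Uu <-]; apply: interior_seg => //; exact: ltW.
have Kseg u : U u -> K (seg z u t) by exists u.
have := @cyclic_monotone3 R p q K (compact_seg_image z t compactU)
  (seg_image_closed segU z t) (fun x Kx => dq x (KI x Kx))
  (fun x Kx => (posJ x (KI x Kx)).1) _ _ _ _ (Kseg _ Ua) (Kseg _ Ub) (Kseg _ Uc).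
have segD u v : seg z u t - seg z v t = t *: (u - v).
  by apply/rowP => i; rewrite !mxE; ring.
rewrite !segD !dotZr -!mulrDr pmulr_rge0//; apply => x v Kx.
have [->|v0] := eqVneq v 0; first by rewrite mul0mx dot0l.
exact/ltW/(posJ _ (KI _ Kx)).2.
Qed.

Lemma normal_point_not_interior u n : U u -> n != 0 ->
  (forall v, U v -> dot n (v - u) <= 0) -> ~ interior (q @` U) (q u).
Proof.
move=> Uu n0 nu /interiorP[d d0 Yd].
have [t t0 tn] : exists2 t : R, 0 < t & t * `|n| < d.
  exists (d / 2 / `|n|); first by rewrite !divr_gt0// normr_gt0.
  by rewrite divfK ?normr_eq0// ltr_pdivrMr// ltr_pMr// ltr1n.
have [a Ua qa] : (q @` U) (q u + t *: n).
  by apply: Yd; rewrite addrAC subrr add0r normrZ gtr0_norm.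
have qau : q a - q u = t *: n by rewrite qa addrAC subrr add0r.
have na : dot n (a - u) = 0.
  apply/eqP; rewrite eq_le nu//=.
  (* With [u] repeated, cyclic monotonicity is plain monotonicity between [a] and [u]. *)
  have := cyclic_monotone_closure _ _ _ Ua Uu Uu.
  rewrite subrr (dotC _ 0) dot0l addr0 -(opprB a u) dotNr -dotNl -dotDl qau.
  by rewrite dotZl pmulr_rge0.
(* Strictness comes from room around [z]: the point [z + s *: n] is still in [U]. *)
have nz : dot n (z - u) < 0.
  have /interiorP[e e0 Ue] := Iz.
  have [s s0 sn] : exists2 s : R, 0 < s & s * `|n| < e.
    exists (e / 2 / `|n|); first by rewrite !divr_gt0// normr_gt0.
    by rewrite divfK ?normr_eq0// ltr_pdivrMr// ltr_pMr// ltr1n.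
  have /nu : U (z + s *: n).
    by apply: Ue; rewrite addrAC subrr add0r normrZ gtr0_norm.
  rewrite addrAC (dotDr (z - u)) dotZr; have := mulr_gt0 s0 (dot_gt0 _ n0); lra.
(* For [y] between [z] and [a], the orthogonality [na] reduces cyclic monotonicity of [a], [u], [y]
   to [0 <= (1 - s) * dot (q y - q u) (z - a)]; dividing by [1 - s] and letting [s] tend to 1
   replaces [q y] by [q a]. *)
have h1 : dot (q u) (z - a) <= dot (q a) (z - a).
  rewrite -{2}(seg1 z a).
  apply: (@within01_lim1_ge _ (fun s => dot (q (seg z a s)) (z - a))).
    exact: (within_dot_seg _ _ _ _ _ segU cq (interior_subset Iz) Ua).
  move=> s s0 s1.
  have Uy : U (seg z a s).
    by apply: segU => //; rewrite ?ltW//; exact: interior_subset.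
  have := cyclic_monotone_closure _ _ _ Ua Uu Uy.
  set y := seg z a s in Uy *.
  have ya : y - a = (1 - s) *: (z - a).
    by rewrite /y; apply/rowP => i; rewrite !mxE; ring.
  have -> : u - y = (u - a) - (y - a) by rewrite opprB addrA subrK.
  have -> : dot (q a) (a - u) = dot (q u) (a - u).
    by apply/eqP; rewrite -subr_eq0 -dotNl -dotDl qau dotZl na mulr0.
  rewrite -(opprB a u) (dotDr (- (a - u))) !dotNr addrA subrr sub0r ya.
  rewrite !dotZr addrC -mulrBr.
  by rewrite pmulr_rge0 ?subr_gt0// subr_ge0.
have : t * dot n (z - a) < 0.
  rewrite pmulr_rlt0//; have -> : z - a = (z - u) - (a - u).
    by rewrite opprB addrA subrK.
  by rewrite dotDr dotNr na subr0.
by rewrite -dotZl -qau dotDl dotNl subr_lt0 ltNge h1.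
Qed.

Lemma preimage_interior x : U x -> interior (q @` U) (q x) -> interior U x.
Proof.
move=> Ux /interiorP[e e0 Ye]; apply: contrapT => nIx.
have e20 : 0 < e / 2 by rewrite divr_gt0.
have /within_continuousP/(_ x Ux (e / 2) e20)[d d0 qd] := cq.
(* Of [p + 2], the part [p + 1] bounds the distance from [w] to its projection [u], and 1 is for the
   distance from [x] to [w]. *)
pose B : R := p%:R + 2.
have B0 : 0 < B by rewrite ltr_wpDl.
have [w wd nUw] : exists2 w, `|w - x| < d / B & ~ U w.
  apply: contrapT => h; apply: nIx; apply/interiorP.
  exists (d / B); first exact: divr_gt0.
  by move=> w wd; apply: contrapT => nUw; apply: h; exists w.
have [u Uu [umin nu]] := ex_projection U w (ex_intro _ x Ux) compactU segU.
have n0 : w - u != 0.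
  by rewrite subr_eq0; apply/eqP => wu; apply: nUw; rewrite wu.
apply: (normal_point_not_interior _ _ Uu n0 nu).
(* The projection minimises the Euclidean distance; passing to the sup norm costs a factor [p] in
   the square, and [p <= (p + 1) ^ 2]. *)
have uw : `|u - w| <= (p%:R + 1) * `|w - x|.
  rewrite -(@ler_pXn2r _ 2)// ?nnegrE ?mulr_ge0// ?addr_ge0//.
  apply: (le_trans (norm_sqr_le_dot _)); apply: (le_trans (umin _ Ux)).
  rewrite -opprB dotNl dotNr opprK.
  apply: (le_trans (ler_norm _)); apply: (le_trans (dot_norm_le _ _)).
  rewrite -expr2 exprMn ler_wpM2r ?exprn_ge0//.
  have := ler0n R p; set P : R := p%:R; nra.
have ux : `|u - x| < d.
  have -> : u - x = (u - w) + (w - x) by rewrite addrA subrK.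
  apply: (le_lt_trans (ler_normD _ _)).
  move: wd; rewrite ltr_pdivlMr// => wd; apply: le_lt_trans wd.
  have -> : `|w - x| * B = (p%:R + 1) * `|w - x| + `|w - x| by rewrite /B; ring.
  by rewrite lerD2r.
apply/interiorP; exists (e / 2) => // y yu; apply: Ye.
have -> : y - q x = (y - q u) + (q u - q x) by rewrite addrA subrK.
apply: (le_lt_trans (ler_normD _ _)).
have := qd _ Uu ux; move: yu; lra.
Qed.

End MonotoneMap.

Theorem mainTheorem8 (R : realType) (p : nat) (U : set 'rV[R]_p)
    (q : 'rV[R]_p -> 'rV[R]_p) :
  compact U ->
  convex_set (U : set (convex_lmodType 'rV[R]_p)) ->
  interior U !=set0 ->
  {within U, continuous q} ->
  (forall x, interior U x -> differentiable q x) ->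
  (forall x, interior U x -> sym_posdef ('J q x)) ->
  convex_set ((q @` U) : set (convex_lmodType 'rV[R]_p)) ->
  {within interior U, continuous q} /\
  set_bij (interior U) (interior (q @` U)) q.
Proof.
move=> cU /convex_set_seg_closed segU [z Iz] cq dq posJ _; split.
  by apply: continuous_subspaceW cq; exact: interior_subset.
split.
- by move=> x Ix; exact: (image_interior_sub cU segU cq dq posJ).
- move=> x y /set_mem Ix /set_mem Iy qxy.
  exact: (injective_interior segU cq dq posJ _ _ Iy (interior_subset Ix) qxy).
- move=> y Iy; have [x Ux qx] := interior_subset Iy.
  exists x => //; rewrite -qx in Iy.
  exact: (preimage_interior cU segU cq dq posJ z Iz _ Ux Iy).
Qed.
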